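(* Let $u\in\mathbb{R}^m$. If there exists $b\in\mathbb{R}^p$ with $\mathcal{P}(b)\neq\emptyset$ such that $$K^+\overline{g}_{\mathcal{P}}(u,b)+K^-\underline{g}_{\mathcal{P}}(u,b)\le b,$$ then $u$ is solvable, i.e. there exists $x$ with $f(x,u)=0$; moreover such an $x$ can be found in $\mathcal{P}(b)$.
   Context: Let $f:\mathbb{R}^n\times\mathbb{R}^m\to\mathbb{R}^n$ be continuous and differentiable, with $f=M\psi$ for a continuously differentiable $\psi:\mathbb{R}^n\times\mathbb{R}^m\to\mathbb{R}^q$ and constant $M\in\mathbb{R}^{n\times q}$. There is a base point $(x_0,u_0)$ with $f(x_0,u_0)=0$ at which $J_{f,0}=\frac{\partial f}{\partial x}\big|_{(x_0,u_0)}$ is nonsingular; $J_{\psi,0}=\frac{\partial \psi}{\partial x}\big|_{(x_0,u_0)}$ and $g(x,u)=\psi(x,u)-J_{\psi,0}x\in\mathbb{R}^q$. Let $\underline{g},\overline{g}:\mathbb{R}^n\times\mathbb{R}^m\to\mathbb{R}^q$ satisfy $\underline{g}_k(x,u)\le g_k(x,u)\le\overline{g}_k(x,u)$ for all $(x,u)$ and $k$. A fixed matrix $A\in\mathbb{R}^{p\times n}$ is chosen so that $\mathcal{P}(b)=\{x:Ax\le b\}$ is bounded for every $b\in\mathbb{R}^p$. Define $\overline{g}_{\mathcal{P},k}(u,b)=\max_{x\in\mathcal{P}(b)}\overline{g}_k(x,u)$ and $\underline{g}_{\mathcal{P},k}(u,b)=\min_{x\in\mathcal{P}(b)}\underline{g}_k(x,u)$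 (assumed attained). Let $K=-AJ_{f,0}^{-1}M\in\mathbb{R}^{p\times q}$ and let $K^+,K^-$ be the matrices with $K^+_{ij}=K_{ij}$ if $K_{ij}>0$ and $0$ otherwise, $K^-_{ij}=K_{ij}$ if $K_{ij}<0$ and $0$ otherwise. $u$ is solvable if there is $x$ with $f(x,u)=0$. Vector inequalities are componentwise. *)

(* Defs.v *)
From HB Require Import structures.
From mathcomp Require Import all_boot all_order all_algebra.
From mathcomp Require Import all_classical all_reals all_analysis.
Set Implicit Arguments. Unset Strict Implicit. Unset Printing Implicit Defensive.
Import Order.TTheory GRing.Theory Num.Theory.
Import numFieldNormedType.Exports.
Local Open Scope classical_set_scope.
Local Open Scope ring_scope.

(* F : U -> V is continuously differentiable: differentiable everywhere and
   z |-> dF(z) is continuous (in finite dimension: z |-> dF(z) h continuous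
   for every direction h). *)
Definition cont_diff (R : realType) (U V : normedModType R) (F : U -> V) : Prop :=
  (forall z, differentiable F z) /\ (forall h : U, continuous (fun z => 'd F z h)).

Definition partial_jac_x (R : realType) (n m k : nat)
  (F : 'cV[R]_n * 'cV[R]_m -> 'cV[R]_k) (x0 : 'cV[R]_n) (u0 : 'cV[R]_m)
  (J : 'M[R]_(k, n)) : Prop :=
  differentiable (fun x => F (x, u0)) x0 /\
  forall h : 'cV[R]_n, 'd (fun x => F (x, u0)) x0 h = J *m h.

Definition Pset (R : realType) (p n : nat) (A : 'M[R]_(p, n)) (b : 'cV[R]_p)
  : set 'cV[R]_n := [set x | forall i, (A *m x) i 0 <= b i 0].

(* \overline{g}_{P,k}(u,b) = max_{x in P(b)} \overline{g}_k(x,u) (written as sup;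
   attainment is a hypothesis of the theorem) *)
Definition gP_hi (R : realType) (p n m q : nat) (A : 'M[R]_(p, n))
  (ghi : 'cV[R]_n -> 'cV[R]_m -> 'cV[R]_q) (u : 'cV[R]_m) (b : 'cV[R]_p)
  : 'cV[R]_q := \col_k sup [set ghi x u k 0 | x in Pset A b].

Definition gP_lo (R : realType) (p n m q : nat) (A : 'M[R]_(p, n))
  (glo : 'cV[R]_n -> 'cV[R]_m -> 'cV[R]_q) (u : 'cV[R]_m) (b : 'cV[R]_p)
  : 'cV[R]_q := \col_k inf [set glo x u k 0 | x in Pset A b].

Definition posPart (R : realType) (p q : nat) (K : 'M[R]_(p, q)) : 'M[R]_(p, q) :=
  \matrix_(i, j) (if 0 < K i j then K i j else 0).
Definition negPart (R : realType) (p q : nat) (K : 'M[R]_(p, q)) : 'M[R]_(p, q) :=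
  \matrix_(i, j) (if K i j < 0 then K i j else 0).

(* Main.v *)
Require Import Defs.
From HB Require Import structures.
From mathcomp Require Import all_boot all_order all_algebra.
From mathcomp Require Import zify.
Import Order.TTheory GRing.Theory Num.Theory.
Set Implicit Arguments. Unset Strict Implicit. Unset Printing Implicit Defensive.

(** The map [T x = x - Jf0^-1 f(x, u)] is continuous and its fixed points are
    the zeros of [f(., u)]. Since [Jf0 = M Jpsi0], one has
    [T x = - Jf0^-1 M g(x, u)], so [A (T x) = K g(x, u)], which for [x] in the
    polytope [P(b)] is at most [K^+ max ghi + K^- min glo <= b]: [T] maps [P(b)]
    into itself and Brouwer's theorem gives the zero.

    Brouwer's theorem is obtained from Scarf's combinatorial lemma on a grid of
    the simplex, which needs no triangulation. A set [s] of grid points and a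
    set [C] of coordinates are dominant when no grid point exceeds, in every
    coordinate of [C], the minimum over [s]; such an [s] has small diameter and
    its coordinates outside [C] are small. Coloring a point by a coordinate that
    the map does not decrease, a parity argument yields a dominant pair in which
    the colors exhaust [C], and cluster points of such [s] are fixed. General
    compact convex sets are retracts of a simplex by Euclidean projection. *)

(** * Scarf's combinatorial lemma *)

(** If [c] is onto on [S], it is injective there and only the point of color [i] can be removed.
    Otherwise a removable point shares its color with exactly one other point of [S], and these two
    are the only removable ones: the count is 0 or 2. *)
Lemma card_missing_color_faces (Z I : finType) (c : Z -> I) (i : I)
    (S : {set Z}) : #|S| = #|I| ->
  odd #|[set z in S | c @: (S :\ z) == ~: [set i]]| = (c @: S == setT).
Proof.
move=> cardS; have [cS|ncS] := eqVneq.
  have cinj : {in S &, injective c}.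
    by apply/imset_injP; rewrite cS cardsT cardS.
  have [z zS ez] : exists2 z, z \in S & i = c z.
    by apply/imsetP; rewrite cS.
  suff -> : [set z in S | c @: (S :\ z) == ~: [set i]] = [set z].
    by rewrite cards1.
  apply/setP => w; rewrite !inE; apply/andP/eqP => [[wS /eqP E]|->].
    apply/eqP/negPn/negP => wz.
    have : i \in c @: (S :\ w).
      by rewrite ez imset_f // !inE eq_sym wz.
    by rewrite E !inE eqxx.
  split=> //; apply/eqP/setP => j; rewrite !inE.
  apply/imsetP/idP => [[y]|].
    rewrite !inE => /andP[yz yS] ->; rewrite ez.
    by apply: contra yz => /eqP /cinj -> //.
  move=> ji; have /imsetP[y yS ej] : j \in c @: S by rewrite cS.
  exists y => //; rewrite !inE yS andbT.
  by apply: contra ji => /eqP yz; rewrite ej yz ez.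
have [->|[z]] := set_0Vmem [set z in S | c @: (S :\ z) == ~: [set i]].
  by rewrite cards0.
rewrite inE => /andP[zS /eqP E].
have cardSz : #|S :\ z| = #|c @: (S :\ z)|.
  by have := cardsD1 z S; have := cardsC1 i; rewrite E zS cardS; lia.
have cinj : {in S :\ z &, injective c} by apply/imset_injP/eqP.
have czi : c z != i.
  apply: contra ncS => /eqP czi; apply/eqP/setP => j; rewrite inE.
  rewrite -(setD1K zS) imsetU1 E !inE czi.
  by case: (j == i).
have [z' z'S cz] : exists2 z', z' \in S :\ z & c z = c z'.
  by apply/imsetP; rewrite E !inE.
suff -> : [set y in S | c @: (S :\ y) == ~: [set i]] = [set z; z'].
  move: z'S; rewrite !inE => /andP[zz' _].
  by rewrite cards2 eq_sym zz'.
move: (z'S); rewrite !inE => /andP[z'z z'inS].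
apply/setP => w; rewrite !inE; apply/andP/orP => [[wS /eqP F]|].
  have [|wz] := eqVneq w z; first by left.
  right; apply/eqP/cinj => //; first by rewrite !inE wz.
  have : c w \in c @: (S :\ w).
    by rewrite F -E imset_f // !inE wz.
  case/imsetP => y; rewrite !inE => /andP[yw yS] cwy.
  have [yz|yz] := eqVneq y z; first by rewrite cwy yz cz.
  by move: yw; rewrite (cinj w y) ?eqxx // !inE ?wz ?yz.
case=> /eqP ->; split=> //; first exact/eqP.
rewrite -E; apply/eqP/setP => j; apply/imsetP/imsetP => -[y].
  rewrite !inE => /andP[yz' yS] ->.
  have [->|yz] := eqVneq y z; first by exists z' => //; rewrite cz.
  by exists y => //; rewrite !inE yz.
rewrite !inE => /andP[yz yS] ->.
have [->|yz'] := eqVneq y z'; first by exists z; rewrite // !inE zS eq_sym z'z.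
by exists y => //; rewrite !inE yz'.
Qed.

(* Sperner's parity argument: count in two ways the pairs (room, face of it
   whose colors are all but [i]). *)
Lemma exists_rainbow (Z I : finType) (c : Z -> I) (room : pred {set Z})
    (i : I) (D0 : {set Z}) :
  (forall S, room S -> #|S| = #|I|) ->
  c @: D0 = ~: [set i] ->
  (forall D : {set Z}, c @: D = ~: [set i] ->
    odd #|[set z | (z \notin D) && room (z |: D)]| = (D == D0)) ->
  exists2 S, room S & c @: S = setT.
Proof.
move=> cardR cD0 door_parity.
have [S /andP[rS /eqP cS]|none] := pickP (fun S => room S && (c @: S == setT)).
  by exists S.
pose door (D : {set Z}) := c @: D == ~: [set i].
have E : \sum_(S | room S) #|[set z in S | door (S :\ z)]| =
         \sum_(D | door D) #|[set z | (z \notin D) && room (z |: D)]|.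
  under eq_bigr do rewrite -sum1_card.
  under [RHS]eq_bigr do rewrite -sum1_card.
  rewrite (exchange_big_dep predT) //= [RHS](exchange_big_dep predT) //=.
  apply: eq_bigr => z _.
  (* Pairs with [z] in [S] correspond to pairs with [z] outside [D] through [S = z |: D]. *)
  rewrite (reindex_onto (fun D => z |: D) (fun S => S :\ z)) /=; last first.
    by move=> S; rewrite !inE => /and3P[_ zS _]; rewrite setD1K.
  apply: eq_bigl => D; rewrite !inE eqxx /=.
  have [zD|zD] /= := boolP (z \in D).
    rewrite andbF; apply/negbTE; apply/negP => /andP[_ /eqP F].
    by move: zD; rewrite -F !inE eqxx.
  by rewrite setU1K // eqxx andbT andbC.
have : odd (\sum_(D | door D) #|[set z | (z \notin D) && room (z |: D)]|).
  rewrite (bigD1 D0) /=; last exact/eqP.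

  rewrite oddD door_parity ?eqxx //= -dvdn2; apply: dvdn_sum => D /andP[/eqP dD nD].
  by rewrite dvdn2 door_parity // (negbTE nD).
rewrite -E -[odd _]negbK -dvdn2 dvdn_sum // => S rS.
by rewrite dvdn2 card_missing_color_faces ?cardR //; have := none S; rewrite rS /= => ->.
Qed.

(** * Dominant sets for a family of injective rankings *)

Section Dominant.
Variables (Z I : finType) (r : I -> Z -> nat).
Hypothesis r_inj : forall i, injective (r i).

(** The index ranges over all of [I]; a proper set of coordinates is recovered later through slack
    elements. *)
Definition dominant (S : {set Z}) :=
  [forall y, exists i, forall z in S, r i y <= r i z].

Lemma dominantP (S : {set Z}) :
  reflect (forall y, exists i, forall z, z \in S -> r i y <= r i z)
          (dominant S).
Proof.
apply: (iffP forallP) => H y.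
  by have /existsP[i /forall_inP Hi] := H y; exists i.
by have [i Hi] := H y; apply/existsP; exists i; apply/forall_inP.
Qed.

Lemma dominant_sub (S S' : {set Z}) : S \subset S' -> dominant S' -> dominant S.
Proof.
move=> /subsetP SS' /dominantP H; apply/dominantP => y.
by have [i Hi] := H y; exists i => z /SS' /Hi.
Qed.

(* [D] has one element fewer than [I], so exactly two indices [i1], [i2] share
   their [r]-minimum over [D]. Each room above [D] frees one of them, say [a]:
   its new element is the [r a]-largest one lying above the minima of [D] for
   all the other indices. *)
Lemma door_in_two_rooms (D : {set Z}) : #|D|.+1 = #|I| -> D != set0 ->
  dominant D ->
  (forall a, exists y, forall i, i != a -> exists2 z, z \in D & r i z < r i y) ->
  #|[set z | (z \notin D) && dominant (z |: D)]| = 2.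
Proof.
move=> cardD /set0Pn[z0 z0D] /dominantP domD above.
pose m i := [arg min_(z < z0 in D) r i z].
have mP i : m i \in D /\ forall z, z \in D -> r i (m i) <= r i z.
  by rewrite /m; case: arg_minnP.
have mD i : m i \in D by case: (mP i).
have m_le i z : z \in D -> r i (m i) <= r i z by case: (mP i) => _; apply.
have min_m i y : y \in D -> (forall z, z \in D -> r i y <= r i z) -> m i = y.
  by move=> yD H; apply/(@r_inj i)/eqP; rewrite eqn_leq m_le ?H.
(* Dominance tested at a point of [D] gives an index whose minimum over [D] is that point. *)
have im_m : m @: setT = D.
  apply/eqP; rewrite eqEsubset; apply/andP; split; apply/subsetP => y.
    by case/imsetP => i _ ->.
  move=> yD; have [i Hi] := domD y.
  by apply/imsetP; exists i => //; rewrite (min_m i y).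
have cardC1 (a : I) : #|[set~ a]| = #|D| by rewrite cardsC1 -cardD.
have onto_inj (a : I) : D \subset m @: [set~ a] -> {in [set~ a] &, injective m}.
  move=> sub; apply/imset_injP; rewrite cardC1; apply/eqP/eqP.
  rewrite eqn_leq -{1}(cardC1 a) leq_imset_card /=.
  exact: subset_leq_card.
have [i1 [i2 [ni12 em]]] : exists i1 i2, i1 != i2 /\ m i1 = m i2.
  have : ~~ injectiveb m.
    apply/negP => /injectiveP m_inj; have := card_imset setT m_inj.
    by rewrite im_m cardsT; move: cardD; lia.
  by case/injectivePn => i1 [i2 n12 e12]; exists i1, i2.
have onto1 a : a \in [set i1; i2] -> forall y, y \in D -> exists2 i, i != a & m i = y.
  move=> aP y; rewrite -im_m => /imsetP[i _ ->].
  have [->|] := eqVneq i a; last by exists i.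
  by move: aP; rewrite !inE => /orP[] /eqP ->;
    [exists i2|exists i1]; rewrite // eq_sym.
pose above_but a y := [forall (i | i != a), r i (m i) < r i y].
have aboveP a : exists y, above_but a y.
  have [y Hy] := above a; exists y; apply/forall_inP => i /Hy[z zD].
  exact: leq_ltn_trans (m_le _ _ zD).
pose x a := [arg max_(y > xchoose (aboveP a) | above_but a y) r a y].
have xP a : above_but a (x a) /\ forall y, above_but a y -> r a y <= r a (x a).
  by rewrite /x; case: arg_maxnP => //; exact: xchooseP.
have x_gt a i : i != a -> r i (m i) < r i (x a).
  by have [/forall_inP H _] := xP a; exact: H.
have x_le a : r a (x a) <= r a (m a).
  have [i Hi] := domD (x a).
  case: (eqVneq i a) Hi => [-> /(_ _ (mD a)) //|/x_gt + Hi].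
  by rewrite ltnNge Hi.
have xD a : a \in [set i1; i2] -> x a \notin D.
  move=> aP; apply/negP => /(onto1 _ aP)[i /x_gt H e].
  by move: H; rewrite e ltnn.
(* A common value would exceed the minimum of [D] in every index, against dominance. *)
have x12 : x i1 != x i2.
  apply/negP => /eqP e; have [i Hi] := domD (x i1).
  have := Hi _ (mD i); rewrite leqNgt => /negP; apply.
  have [->|/x_gt//] := eqVneq i i1.
  by rewrite e x_gt.
suff -> : [set z | (z \notin D) && dominant (z |: D)] = [set x i1; x i2].
  by rewrite cards2 x12.
apply/setP => z; rewrite !inE; apply/andP/idP => [[zD /dominantP dom]|]; last first.
  move=> zx; have [a aP ->] : exists2 a, a \in [set i1; i2] & z = x a.
    by case/orP: zx => /eqP ->; [exists i1|exists i2]; rewrite // !inE eqxx ?orbT.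
  split; first exact: xD.
  apply/dominantP => y.
  have [/forall_inP ay|] := boolP (above_but a y).
    exists a => w; rewrite !inE => /orP[/eqP ->|wD].
      by case: (xP a) => _; apply; apply/forall_inP.
    apply: leq_trans (m_le _ _ wD); apply: leq_trans (x_le a).
    by case: (xP a) => _; apply; apply/forall_inP.
  case/forall_inPn => i ia; rewrite -leqNgt => iy; exists i => w.
  rewrite !inE => /orP[/eqP ->|wD]; apply: leq_trans iy _.
    exact/ltnW/x_gt.
  exact: m_le.
(* The new point [z] is the minimum of the enlarged set for [a]; the points of [D] must then be the
   minima for the other indices. *)
have [a za] := dom z.
have za_lt w : w \in D -> r a z < r a w.
  move=> wD; rewrite ltn_neqAle za ?inE ?wD ?orbT // andbT.
  by apply: contra zD => /eqP /r_inj ->.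
have pre w : w \in D -> exists2 i, i != a & m i = w /\ r i w < r i z.
  move=> wD; have [i Hi] := dom w; exists i.
    apply/negP => /eqP ia; have := Hi z; rewrite ia !inE eqxx => /(_ isT).
    by rewrite leqNgt za_lt.
  split; first by apply: min_m => // v vD; apply: Hi; rewrite !inE vD orbT.
  rewrite ltn_neqAle Hi ?inE ?eqxx // andbT.
  by apply: contra zD => /eqP /r_inj <-.
have m_inj : {in [set~ a] &, injective m}.
  apply: onto_inj; apply/subsetP => w /pre[i ia [<- _]].
  by apply: imset_f; rewrite !inE.
have a12 : (a == i1) || (a == i2).
  apply/negPn/negP; rewrite negb_or ![a == _]eq_sym => /andP[a1 a2].
  by move/negP: ni12; apply; apply/eqP/m_inj; rewrite ?inE.
have zabove : above_but a z.
  apply/forall_inP => i ia; have [j ja [mij lt]] := pre _ (mD i).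
  suff ij : i = j by move: lt; rewrite -ij.
  by apply: m_inj; rewrite ?inE.
suff -> : z = x a by case/orP: a12 => /eqP ->; rewrite eqxx ?orbT.
apply/(@r_inj a)/eqP; rewrite eqn_leq (proj2 (xP a)) //=.
have [i Hi] := dom (x a).
case: (eqVneq i a) Hi => [-> Hi|ia Hi]; first by apply: Hi; rewrite !inE eqxx.
by have := Hi (m i); rewrite !inE mD orbT leqNgt x_gt // => /(_ isT).
Qed.
End Dominant.

(* Scarf's slack elements: [Z = T + I], where [inr i] is lowest for [i] and above
   all of [T] for the other indices; a room [S] then encodes the pair formed by
   [S] restricted to [T] and the set of the [i] such that [inr i] is not in [S]. *)
Lemma exists_rainbow_dominant (T I : finType) (w : I -> T -> nat) (c : T -> I)
    (x0 : T) :
  exists (s : {set T}) (C : {set I}),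
    (forall y, exists2 i, i \in C & forall x, x \in s -> w i y <= w i x) /\
    (forall i, i \in C -> exists2 x, x \in s & c x = i).
Proof.
(* The summand [enum_rank x] breaks ties between equal weights. *)
pose rT i x := (w i x * #|T| + enum_rank x).+1.
have rT_mono i x y : rT i x <= rT i y -> w i x <= w i y.
  apply: contraTT; rewrite -!ltnNge ltnS => lt.
  apply: (@leq_trans ((w i y).+1 * #|T|)).
    by rewrite mulSn [X in _ < X]addnC ltn_add2l ltn_ord.
  by apply: leq_trans (leq_addr _ _); rewrite leq_mul2r lt orbT.
have rT_inj i : injective (rT i).
  move=> x y [] /(congr1 (modn^~ #|T|)); rewrite !modnMDl !modn_small //.
  by move/val_inj/enum_rank_inj.
pose B := (\max_i \max_x rT i x).+1.
have rT_lt i x : rT i x < B.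
  by rewrite ltnS (leq_trans _ (leq_bigmax i)) //; exact: (leq_bigmax x).
pose r i (z : T + I) := match z with
  | inl x => rT i x
  | inr j => if j == i then 0 else B + enum_rank j end.
have r_inj i : injective (r i).
  move=> [x|j] [y|k] /=.
  - by move/rT_inj->.
  - by case: eqP => // _ e; have := rT_lt i x; rewrite e; lia.
  - by case: eqP => // _ e; have := rT_lt i y; rewrite -e; lia.
  - case: (eqVneq j i) => [->|_]; case: (eqVneq k i) => [->|_] //.
    by move/addnI/val_inj/enum_rank_inj->.
pose cZ (z : T + I) := match z with inl x => c x | inr j => j end.
(* The starting door has all slack elements except that of [i0]; any index would do for [i0]. *)
pose i0 := c x0; pose D0 := [set (inr j : T + I) | j in [set~ i0]].
have inlD0 x : inl x \notin D0 by apply/imsetP => -[].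
have inrD0 j : (inr j \in D0) = (j != i0).
  rewrite mem_imset; last by move=> ? ? [].
  by rewrite !inE.
have cardD0 : #|D0|.+1 = #|I|.
  rewrite card_imset; last by move=> ? ? [].
  by rewrite cardsC1 prednK //; apply/card_gt0P; exists i0.
have high i x j : j != i -> rT i x < r i (inr j).
  by move=> ji /=; rewrite (negbTE ji); have := rT_lt i x; lia.
have domD0 : dominant r D0.
  apply/dominantP => -[y|j]; last by exists j => z _ /=; rewrite eqxx.
  exists i0 => -[x|j]; first by rewrite (negbTE (inlD0 x)).
  by rewrite inrD0 => /(high i0 y)/ltnW.
pose room (S : {set T + I}) := dominant r S && (#|S| == #|I|).
have [S /andP[/dominantP domS /eqP cardS] rainbow] :
    exists2 S, room S & cZ @: S = [set: I].
  apply: (@exists_rainbow _ _ cZ room i0 D0).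
  - by move=> S /andP[_ /eqP].
  - by rewrite /D0 -imset_comp /= imset_id.
  move=> D cD; have [cardD|cardD] := eqVneq #|D|.+1 #|I|; last first.
    have /negbTE -> : D != D0 by apply: contra cardD => /eqP ->; rewrite cardD0.
    rewrite (_ : [set _ | _] = set0) ?cards0 //.
    apply/setP => z; rewrite !inE /room cardsU1; case: (z \in D) => //=.
    by rewrite add1n (negbTE cardD) andbF.
  have [domD|domD] := boolP (dominant r D); last first.
    have /negbTE -> : D != D0 by apply: contra domD => /eqP ->.
    rewrite (_ : [set _ | _] = set0) ?cards0 //.
    apply/setP => z; rewrite !inE; apply/negP => /and3P[_ + _].
    by move/(dominant_sub (subsetUr _ _)); apply/negP.
  have -> : [set z | (z \notin D) && room (z |: D)] =
            [set z | (z \notin D) && dominant r (z |: D)].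
    apply/setP => z; rewrite !inE /room cardsU1; case: (z \in D) => //=.
    by rewrite add1n cardD eqxx andbT.
  (* A door containing a point of [T] lies in two rooms; one made of slack elements alone must be
     [D0], by its colors. *)
  have [x xD|noT] := pickP (fun x => inl x \in D).
    have /negbTE -> : D != D0.
      by apply/negP => /eqP e; move: xD; rewrite e (negbTE (inlD0 x)).
    rewrite (door_in_two_rooms r_inj) //; first by apply/set0Pn; exists (inl x).
    move=> a; exists (inr a) => i ia; exists (inl x) => //.
    by apply: high; rewrite eq_sym.
  have -> : D = D0.
    apply/setP => -[x|j]; first by rewrite noT (negbTE (inlD0 x)).
    rewrite inrD0; have : (j \in cZ @: D) = (j != i0) by rewrite cD !inE.
    move=> <-; apply/idP/imsetP => [jD|[[x|k] + /= ->] //]; last by rewrite noT.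
    by exists (inr j).
  (* The only room above [D0] adds the point of [T] largest for [i0]: adding [inr i0] instead would
     make the minimum 0 in every index and destroy dominance. *)
  rewrite eqxx; pose t := [arg max_(x > x0) rT i0 x].
  have tP x : rT i0 x <= rT i0 t.
    by rewrite /t; case: arg_maxnP => // y _; exact.
  rewrite (_ : [set _ | _] = [set inl t]) ?cards1 //.
  have dom0 : dominant r (inl t |: D0).
    apply/dominantP => -[y|j]; last by exists j => z _ /=; rewrite eqxx.
    exists i0 => -[x|j]; rewrite !inE ?inrD0.
      by rewrite (negbTE (inlD0 x)) orbF => /eqP[->]; exact: tP.
    by move=> /(high i0 y)/ltnW.
  apply/setP => -[x|j]; rewrite !inE ?inlD0 ?inrD0 /=.
    apply/idP/eqP => [/dominantP /(_ (inl t))[i Hi]|[->] //].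
    have ii0 : i = i0.
      apply/eqP/negPn/negP => ii0; have := Hi (inr i).
      by rewrite !inE inrD0 ii0 orbT /= eqxx => /(_ isT).
    congr inl; apply: (rT_inj i0); apply/eqP; rewrite eqn_leq tP.
    by have := Hi (inl x); rewrite ii0 !inE eqxx; apply.
  apply/negbTE; apply/negP => /andP[]; rewrite negbK => /eqP -> /dominantP.
  case/(_ (inl x0)) => i /(_ (inr i)); rewrite !inE inrD0 /= eqxx.
  by have [->|_] := eqVneq i i0; rewrite ?eqxx ?orbT //= => /(_ isT).
exists [set x | inl x \in S], [set i | inr i \notin S]; split=> [y|i].
  have [i Hi] := domS (inl y); exists i.
    by rewrite inE; apply/negP => /Hi /=; rewrite eqxx.
  by move=> x; rewrite inE => /Hi /rT_mono.
rewrite inE => iS; have /imsetP[[x|j] zS /= e] : i \in cZ @: S.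
- by rewrite rainbow.
- by exists x; rewrite ?inE.
- by rewrite e zS in iS.
Qed.

(** * Dominant pairs on a grid of the simplex *)

Section Grid.
Variables n N : nat.

Definition sums_to (x : {ffun 'I_n.+1 -> 'I_N.+1}) := \sum_i x i == N.

Definition grid := {x | sums_to x}.

Definition grid_coord (x : grid) (i : 'I_n.+1) : nat := val x i.

Lemma sum_grid_coord x : \sum_i grid_coord x i = N.
Proof. by apply/eqP; exact: valP x. Qed.

Lemma grid_above (C : {set 'I_n.+1}) (m : 'I_n.+1 -> nat) :
  C != set0 -> \sum_(i in C) m i <= N ->
  exists y : grid, forall i, i \in C -> m i <= grid_coord y i.
Proof.
move=> /set0Pn[i0 i0C] le; set s := \sum_(i in C) _ in le.
pose v i := (if i \in C then m i else 0) + (if i == i0 then N - s else 0).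
have sum_v : \sum_i v i = N.
  rewrite big_split /= -big_mkcond /= -[X in _ + X]big_mkcond /= big_pred1_eq.
  by rewrite -/s; lia.
have v_le i : v i < N.+1 by rewrite ltnS -sum_v (bigD1 i) //= leq_addr.
have ok : sums_to [ffun i => Ordinal (v_le i)].
  by apply/eqP; rewrite -[RHS]sum_v; apply: eq_bigr => i _; rewrite ffunE.
exists (exist sums_to _ ok : grid) => i iC; rewrite /grid_coord /= ffunE /= /v iC.
exact: leq_addr.
Qed.

(** Dominance makes the minima over [s] of the coordinates in [C] add up to almost [N]. Little is
    then left for a coordinate in [C] to exceed its minimum, or for one outside [C] to be large. *)
Lemma grid_color (c : grid -> 'I_n.+1) :
  exists x : grid, forall i, grid_coord x i <= n.+1 \/
    exists2 y : grid, c y = i &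
      forall j, grid_coord y j <= grid_coord x j + n.+1
             /\ grid_coord x j <= grid_coord y j + n.+1.
Proof.
have [g0 _] : exists y : grid, forall i, i \in [set: 'I_n.+1] ->
    (fun=> 0) i <= grid_coord y i.
  apply: grid_above; first by apply/set0Pn; exists ord0; rewrite inE.
  by rewrite big1.
have [s [C [dom rain]]] :=
  exists_rainbow_dominant (fun i x => grid_coord x i) c g0.
have [iC iCC _] := dom g0.
have C0 : C != set0 by apply/set0Pn; exists iC.
have [x0 x0s _] := rain _ iCC.
pose m i := grid_coord [arg min_(x < x0 in s) grid_coord x i] i.
have m_le i x : x \in s -> m i <= grid_coord x i.
  by rewrite /m; case: arg_minnP => // y _ H /H.
have m_in i : exists2 x, x \in s & m i = grid_coord x i.
  by rewrite /m; case: arg_minnP => // y ys _; exists y.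
(* Otherwise all the minima could be raised by 1, at a total cost of at most [n.+1], and a grid
   point would still fit above them, against dominance. *)
have sum_m : N < \sum_(i in C) m i + n.+1.
  rewrite ltnNge; apply/negP => le.
  have [||y Hy] := @grid_above C (fun i => (m i).+1) => //.
    apply: leq_trans le; rewrite -[X in X <= _]/(\sum_(i in C) (1 + m i)).
    rewrite big_split /= sum1_card addnC leq_add2l.
    by have := max_card (mem C); rewrite card_ord.
  have [i iiC Hi] := dom y; have [x xs mx] := m_in i.
  by have := Hi x xs; rewrite -mx leqNgt Hy.
have sum_C x : \sum_(j in C) grid_coord x j <= N.
  by rewrite -(sum_grid_coord x) [leqRHS](bigID (mem C)) leq_addr.
have close x i : x \in s -> i \in C -> grid_coord x i <= m i + n.+1.
  move=> xs iiC.
  have split_i (F : 'I_n.+1 -> nat) :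
    \sum_(j in C) F j = F i + \sum_(j in C | j != i) F j by exact: bigD1.
  have := sum_C x; have := sum_m; rewrite !split_i.
  have : \sum_(j in C | j != i) m j <= \sum_(j in C | j != i) grid_coord x j.
    by apply: leq_sum => j _; exact: m_le.
  by lia.
have small x i : x \in s -> i \notin C -> grid_coord x i <= n.+1.
  move=> xs iiC; have : grid_coord x i + \sum_(j in C) grid_coord x j <= N.
    rewrite -[leqRHS](sum_grid_coord x) [leqRHS](bigD1 i) //= leq_add2l.
    rewrite big_mkcond [leqRHS]big_mkcond; apply: leq_sum => j _.
    by case: (eqVneq j i) => [->|_]; rewrite ?(negbTE iiC) //; case: ifP.
  have : \sum_(j in C) m j <= \sum_(j in C) grid_coord x j.
    by apply: leq_sum => j _; exact: m_le.
  by lia.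
have diam x y j : x \in s -> y \in s -> grid_coord x j <= grid_coord y j + n.+1.
  move=> xs ys; have [jC|jC] := boolP (j \in C).
    by apply: leq_trans (close _ _ xs jC) _; rewrite leq_add2r m_le.
  by apply: leq_trans (small _ _ xs jC) _; rewrite leq_addl.
exists x0 => i; have [iiC|iiC] := boolP (i \in C); last by left; exact: small.
by right; have [y ys cy] := rain _ iiC; exists y => // j; rewrite !diam.
Qed.
End Grid.

From mathcomp Require Import all_classical all_reals all_analysis.
From mathcomp Require Import ring lra.
Import numFieldNormedType.Exports.
Local Open Scope classical_set_scope.
Local Open Scope ring_scope.

(** * Brouwer's fixed-point theorem *)

Section MatrixTopology.
Variable R : realType.

Lemma le_mx_norm m n (A : 'M[R]_(m, n)) i j : `|A i j| <= `|A|.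
Proof.
rewrite [leRHS]/Num.Def.normr /= mx_normrE.
exact: (le_bigmax 0 (fun ij : 'I_m * 'I_n => `|A ij.1 ij.2|) (i, j)).
Qed.

Lemma mx_norm_le m n (A : 'M[R]_(m, n)) (e : R) : 0 <= e ->
  (forall i j, `|A i j| <= e) -> `|A| <= e.
Proof.
by move=> e0 Ae; rewrite [leLHS]/Num.Def.normr /= mx_normrE bigmax_le // => -[i j] _.
Qed.

Lemma continuous_mx (T : topologicalType) m n (f : T -> 'M[R]_(m, n)) :
  (forall i j, continuous (fun x => f x i j)) -> continuous f.
Proof.
move=> cf x; apply/cvgrPdist_le => e e0.
near=> y; apply: mx_norm_le => [|i j]; first exact: ltW.
rewrite !mxE; move: i j; near: y.
apply: filter_forall => i; apply: filter_forall => j.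
by have /cvgrPdist_le := cf i j x; apply.
Unshelve. all: by end_near. Qed.

Lemma continuous_sumr (T : topologicalType) (I : Type) (s : seq I) (P : pred I)
    (f : I -> T -> R) :
  (forall i, P i -> continuous (f i)) ->
  continuous (fun x => \sum_(i <- s | P i) f i x).
Proof. by move=> cf; apply: continuous_big => //; exact: add_continuous. Qed.

Lemma continuous_mulmx m n p (A : 'M[R]_(m, n)) :
  continuous (mulmx A : 'M[R]_(n, p) -> 'M[R]_(m, p)).
Proof.
apply: continuous_mx => i j.
have -> : (fun B : 'M[R]_(n, p) => (A *m B) i j) = (fun B => \sum_k A i k * B k j).
  by apply/funext => B; rewrite mxE.
apply: continuous_sumr => k _ x.
by apply: continuousM; [exact: cst_continuous|exact: coord_continuous].
Qed.

Lemma bounded_closed_compact_cV n (A : set 'cV[R]_n) :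
  bounded_set A -> closed A -> compact A.
Proof.
have ctr k l : continuous (trmx : 'M[R]_(k, l) -> 'M[R]_(l, k)).
  apply: continuous_mx => i j.
  have -> : (fun B : 'M[R]_(k, l) => B^T i j) = (fun B => B j i).
    by apply/funext => B; rewrite mxE.
  exact: coord_continuous.
move=> [M [Mreal AM]] cA.
have -> : A = trmx @` [set v : 'rV[R]_n | A v^T].
  apply/seteqP; split=> [v Av|_ [v Av <-] //].
  by exists v^T; rewrite /= trmxK.
apply: continuous_compact; first by apply: continuous_subspaceT; exact: ctr.
apply: bounded_closed_compact.
  exists M; split=> // N /AM AN v /AN; apply: le_trans.
  by apply: mx_norm_le => // i j; have := le_mx_norm v^T j i; rewrite mxE.
by apply: preimage_closed cA => v _; exact: ctr.
Qed.
End MatrixTopology.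

(** * Fixed points of bounded continuous maps *)

Section BoundedFixpoint.
Variables (R : realType) (n : nat) (B : R).

(* Up to the common factor [c], the barycentric coordinates of [v] in the
   simplex [{v | - B <= v_k, \sum_k (v_k + B) <= c}]; they add up to [c]. *)
Definition bary (c : R) (i : 'I_n.+1) (v : 'cV[R]_n) : R :=
  if unlift ord0 i is Some k then v k 0 + B else c - \sum_k (v k 0 + B).

Lemma sum_bary c v : \sum_i bary c i v = c.
Proof.
rewrite big_ord_recl /bary unlift_none; under [X in _ + X]eq_bigr do rewrite liftK.
by rewrite subrK.
Qed.

Lemma bary_eq c v w : (forall i, bary c i v = bary c i w) -> v = w.
Proof.
move=> e; apply/colP => k; have := e (lift ord0 k).
by rewrite /bary liftK => /addIr.
Qed.

Lemma continuous_bary c i : continuous (bary c i).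
Proof.
have coord k : continuous (fun v : 'cV[R]_n => v k 0 + B).
  by move=> v; apply: continuousD; [exact: coord_continuous|exact: cst_continuous].
rewrite /bary; case: unliftP => [k _|_]; first exact: coord.
move=> v; apply: continuousB; first exact: cst_continuous.
exact: continuous_sumr.
Qed.

(** Ever finer grids of a simplex containing the ball of radius [B] give points at which each
    coordinate is small or is not decreased by [g] at some nearby point. At a cluster point no
    coordinate decreases, and equal sums turn this into equality. *)
Lemma bounded_continuous_fixpoint (g : 'cV[R]_n -> 'cV[R]_n) :
  continuous g -> (forall x, `|g x| <= B) -> exists x, g x = x.
Proof.
move=> cg gB.
have B0 : 0 <= B := le_trans (normr_ge0 _) (gB 0).
have gB' v k : `|g v k 0| <= B by apply: le_trans (gB v); exact: le_mx_norm.
(* For [v] of norm at most [B], the sum of the [v k 0 + B] is at most [n%:R * (B + B)], so all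
   barycentric coordinates are nonnegative; the extra 1 keeps [c] positive even if [n] or [B] is
   0. *)
pose c := n%:R * (B + B) + 1.
have c0 : 0 < c by rewrite ltr_pwDr // mulr_ge0 // addr_ge0.
have bary_ge0 i v : 0 <= bary c i (g v).
  rewrite /bary; case: unliftP => [k _|_].
    by have := gB' v k; rewrite ler_norml => /andP[]; lra.
  rewrite subr_ge0; apply: (@le_trans _ _ (\sum_(k < n) (B + B))).
    apply: ler_sum => k _.
    by have := gB' v k; rewrite ler_norml => /andP[]; lra.
  by rewrite sumr_const card_ord -mulr_natl lerDl.
pose pt N (x : grid n N.+1) : 'cV[R]_n :=
  \col_k (c * (grid_coord x (lift ord0 k))%:R / N.+1%:R - B).
have bary_pt N (x : grid n N.+1) i :
    bary c i (pt N x) = c * (grid_coord x i)%:R / N.+1%:R.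
  have N0 : N.+1%:R != 0 :> R by rewrite pnatr_eq0.
  rewrite /bary; case: unliftP => [k ->|->]; first by rewrite !mxE subrK.
  under eq_bigr do rewrite mxE subrK -mulrA.
  rewrite -mulr_sumr -mulr_suml -natr_sum -mulrA.
  have := sum_grid_coord x; rewrite big_ord_recl => /(congr1 (fun k => k%:R : R)).
  rewrite natrD => /(canRL (addrK _)) ->.
  by rewrite mulrBl divff // mulrBr mulr1.
pose small N (a : R) := a <= c * n.+1%:R / N.+1%:R.
have /choice[s Hs] N : exists v : 'cV[R]_n, (`|v| <= c + B) /\
    forall i, small N (bary c i v) \/
      exists2 w, small N `|v - w| & bary c i w <= bary c i (g w).
  (* The coordinates of a point and of its image both sum to [c], so they cannot all decrease. *)
  have col (x : grid n N.+1) : exists i, bary c i (pt N x) <= bary c i (g (pt N x)).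
    apply: contrapT => no.
    suff : \sum_i bary c i (g (pt N x)) < \sum_i bary c i (pt N x).
      by rewrite !sum_bary ltxx.
    apply: ltr_sum => [|i _]; first by apply/hasP; exists ord0; rewrite ?mem_index_enum.
    by rewrite ltNge; apply/negP => le; apply: no; exists i.
  have N0 : 0 < N.+1%:R :> R by rewrite ltr0n.
  have [x Hx] := grid_color (fun x => xchoose (col x)).
  exists (pt N x); split.
    apply: mx_norm_le => [|k j]; first by rewrite addr_ge0 // ltW.
    rewrite mxE (le_trans (ler_normB _ _)) // (ger0_norm B0) lerD2r.
    rewrite ger0_norm; last by rewrite divr_ge0 ?mulr_ge0 // ltW.
    rewrite ler_pdivrMr // ler_pM2l // ler_nat.
    rewrite (leq_trans _ (eq_leq (sum_grid_coord x))) //.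
    by rewrite (bigD1 (lift ord0 k)) //= leq_addr.
  move=> i; case: (Hx i) => [le|[y cy close]]; [left|right].
    by rewrite /small bary_pt ler_pM2r ?invr_gt0 // ler_pM2l // ler_nat.
  exists (pt N y); last by have := xchooseP (col y); rewrite cy.
  apply: mx_norm_le => [|k j]; first by rewrite divr_ge0 ?mulr_ge0 // ltW.
  rewrite !mxE opprB addrA subrK -mulrBl -mulrBr normrM normrM.
  rewrite (gtr0_norm c0) normfV normr_nat ler_pM2r ?invr_gt0 // ler_pM2l //.
  have [] := close (lift ord0 k).
  by rewrite -!(ler_nat R) !natrD ler_norml => h1 h2; apply/andP; split; lra.
pose K := [set v : 'cV[R]_n | `|v| <= c + B].
have cK : compact K.
  apply: bounded_closed_compact_cV.
    exists (c + B); split; first exact: num_real.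
    by move=> M cM v /= vc; apply: le_trans vc (ltW cM).
  by apply: preimage_closed (@closed_le _ (c + B)) => v _; exact: norm_continuous.
have [p [_ clp]] : K `&` cluster (s @ \oo) !=set0.
  by apply: cK; exists 0%N => // N _; exact: (proj1 (Hs N)).
suff le_bary i : bary c i p <= bary c i (g p).
  exists p; apply: (@bary_eq c) => i; apply/eqP; rewrite eq_le le_bary andbT.
  rewrite leNgt; apply/negP => lt.
  suff : \sum_j bary c j p < \sum_j bary c j (g p) by rewrite !sum_bary ltxx.
  by rewrite (bigD1 i) //= [ltRHS](bigD1 i) //= ltr_leD // ler_sum.
rewrite leNgt; apply/negP => lt.
have p0 : 0 < bary c i p by exact: le_lt_trans (bary_ge0 _ _) lt.
have near_lt : \forall v \near p, bary c i (g v) < bary c i v.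
  have cd : continuous (fun v => bary c i v - bary c i (g v)).
    move=> v; apply: continuousB; first exact: continuous_bary.
    by apply: (@continuous_comp _ _ _ g); [exact: cg|exact: continuous_bary].
  have /cvgr_gt/(_ 0) := cd p; rewrite subr_gt0 => /(_ lt).
  by apply: filterS => v; rewrite subr_gt0.
have [e e0 He] : exists2 e : R, 0 < e & forall v, `|p - v| < e -> bary c i (g v) < bary c i v.
  by have /nbhs_ballP[e e0 He] := near_lt; exists e => // v pv; apply: He; rewrite -ball_normE.
(* The bound [e / 2] keeps both [v] and its neighbor [w] within [e] of [p]; the bound
   [bary c i p / 2] excludes that the coordinate of [v] is small. *)
pose d := Num.min (e / 2) (bary c i p / 2).
have d0 : 0 < d by rewrite lt_min !divr_gt0.
pose d' := d / (c * n.+1%:R).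
have d'0 : 0 < d' by rewrite divr_gt0 // mulr_gt0.
have [v [[N [sv Nd]] [pv bv]]] : [set v | exists N, s N = v /\ N.+1%:R^-1 < d'] `&`
    [set v | `|p - v| < d /\ bary c i p / 2 < bary c i v] !=set0.
  apply: clp.
    have := near_infty_natSinv_lt (PosNum d'0).
    by apply: filterS => N /= lN; exists N.
  near=> v; split; near: v.
    by have := nbhsx_ballx p _ d0; rewrite -ball_normE.
  by have /cvgr_gt := @continuous_bary c i p; apply; rewrite ltr_pdivrMr // ltr_pMr // ltr1n.
have smallP a : small N a -> a < d.
  move=> /le_lt_trans; apply; rewrite mulrC -ltr_pdivlMr //; exact: mulr_gt0.
have de : d <= e / 2 by rewrite ge_min lexx.
have dp : d <= bary c i p / 2 by rewrite ge_min lexx orbT.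
have [_ /(_ i)] := Hs N; rewrite sv => -[/smallP|[w /smallP vw]].
  by move: dp bv; lra.
rewrite leNgt => /negP; apply; apply: He.
have -> : p - w = (p - v) + (v - w) by rewrite addrA subrK.
by apply: le_lt_trans (ler_normD _ _) _; lra.
Unshelve. all: by end_near. Qed.
End BoundedFixpoint.

(** * Euclidean projection and Brouwer's theorem on compact convex sets *)

Section ConvexProjection.
Variables (R : realType) (n : nat).
Implicit Types x y z : 'cV[R]_n.

Definition dotcV x y : R := \sum_i x i 0 * y i 0.

Lemma dotcVDl x y z : dotcV (x + y) z = dotcV x z + dotcV y z.
Proof. by rewrite -big_split; apply: eq_bigr => i _; rewrite mxE mulrDl. Qed.

Lemma dotcVZl t x y : dotcV (t *: x) y = t * dotcV x y.
Proof. by rewrite mulr_sumr; apply: eq_bigr => i _; rewrite mxE mulrA. Qed.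

Lemma dotcVC x y : dotcV x y = dotcV y x.
Proof. by apply: eq_bigr => i _; rewrite mulrC. Qed.

Lemma sqr_dotcVD x y t : dotcV (x + t *: y) (x + t *: y) =
  dotcV x x + t * (2 * dotcV x y + t * dotcV y y).
Proof.
rewrite dotcVDl dotcVZl ![dotcV _ (x + _)]dotcVC !dotcVDl !dotcVZl.
by rewrite [dotcV y x]dotcVC; ring.
Qed.

Lemma dotcV_ge0 x : 0 <= dotcV x x.
Proof. by apply: sumr_ge0 => i _; rewrite -expr2 sqr_ge0. Qed.

Lemma dotcV_le x y : dotcV x y <= n%:R * (`|x| * `|y|).
Proof.
apply: (@le_trans _ _ (\sum_(i < n) `|x| * `|y|)).
  apply: ler_sum => i _; rewrite (le_trans (ler_norm _)) // normrM.
  by rewrite ler_pM // le_mx_norm.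
by rewrite sumr_const card_ord mulr_natl.
Qed.

(** The matrix norm is the maximum norm, hence at most the Euclidean one. *)
Lemma sqr_norm_le_dotcV x : `|x| ^+ 2 <= dotcV x x.
Proof.
rewrite -[leRHS]sqr_sqrtr ?dotcV_ge0 // lerXn2r ?nnegrE ?sqrtr_ge0 //.
apply: mx_norm_le => [|i j]; first exact: sqrtr_ge0.
rewrite ord1 -sqrtr_sqr ler_wsqrtr // /dotcV (bigD1 i) //= -expr2 lerDl.
by apply: sumr_ge0 => k _; rewrite -expr2 sqr_ge0.
Qed.

Definition convex_cV (K : set 'cV[R]_n) :=
  forall x y (t : R), K x -> K y -> 0 <= t <= 1 -> K (x + t *: (y - x)).

(** The point minimizes the squared distance to [y]; were the inequality violated at [x], a suitable
    move from [p] towards [x] would reduce that distance. *)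
Lemma exists_nearest_point (K : set 'cV[R]_n) y :
  compact K -> convex_cV K -> K !=set0 ->
  exists2 p, K p & forall x, K x -> dotcV (y - p) (x - p) <= 0.
Proof.
move=> cK convK K0; pose sqd x := dotcV (x - y) (x - y).
have csqd : continuous sqd.
  apply: continuous_sumr => i _.
  have ch : continuous (fun x => (x - y) i 0).
    have -> : (fun x => (x - y) i 0) = (fun x => x i 0 - y i 0).
      by apply/funext => x; rewrite !mxE.
    by move=> x; apply: continuousB; [exact: coord_continuous|exact: cst_continuous].
  by move=> x; exact: (cvgM (ch x) (ch x)).
have [p pK pmin] := compact_EVT_min K0 cK (continuous_subspaceT csqd).
rewrite inE in pK; exists p => // x xK.
pose a := dotcV (p - y) (x - p); pose q := dotcV (x - p) (x - p).
have -> : dotcV (y - p) (x - p) = - a.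
  by rewrite /a -mulN1r -dotcVZl scaleN1r opprB.
rewrite oppr_le0 leNgt; apply/negP => a0.
have q0 : 0 <= q by exact: dotcV_ge0.
have descent t : 0 < t <= 1 -> 0 <= 2 * a + t * q.
  move=> /andP[t0 t1]; rewrite -(pmulr_rge0 _ t0).
  have tK : K (p + t *: (x - p)) by apply: convK; rewrite // (ltW t0).
  have := pmin _ (mem_set tK).
  have -> : sqd (p + t *: (x - p)) = sqd p + t * (2 * a + t * q).
    by rewrite /sqd addrAC sqr_dotcVD.
  by rewrite lerDl.
have qa : 0 < q - a by lra.
(* As [a < 0 <= q], this step length is positive and at most 1, and it makes [2 * a + t * q]
   negative, even for [q = 0]. *)
have := descent (- a / (q - a)); rewrite divr_gt0 ?oppr_gt0 //=.
rewrite ler_pdivrMr // mul1r lerBrDr addNr q0 => /(_ isT).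
have -> : 2 * a + - a / (q - a) * q = a * (q - 2 * a) / (q - a).
  by field; rewrite gt_eqF.
by rewrite leNgt pmulr_llt0 ?invr_gt0 // nmulr_rlt0 //; lra.
Qed.

Lemma exists_retraction (K : set 'cV[R]_n) :
  compact K -> convex_cV K -> K !=set0 ->
  exists P : 'cV[R]_n -> 'cV[R]_n,
    [/\ continuous P, forall y, K (P y) & forall x, K x -> P x = x].
Proof.
move=> cK convK K0.
have /choice[P HP] y : exists p, K p /\ forall x, K x -> dotcV (y - p) (x - p) <= 0.
  by have [p] := exists_nearest_point y cK convK K0; exists p.
have PK y : K (P y) by case: (HP y).
have Pvar y x : K x -> dotcV (y - P y) (x - P y) <= 0 by case: (HP y) => _; apply.
exists P; split=> // [y|x xK]; last first.
  apply/esym/eqP; rewrite -subr_eq0 -normr_eq0 -sqrf_eq0 eq_le sqr_ge0 andbT.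
  exact: le_trans (sqr_norm_le_dotcV _) (Pvar _ _ xK).
(* Adding the variational inequalities at [y] and [z] bounds the squared Euclidean norm of
   [P y - P z] by its dot product with [y - z]; the factor [n] comes from using the maximum norm. *)
have lipP z : `|P y - P z| <= n%:R * `|y - z|.
  have [->|nz] := eqVneq (P y - P z) 0; first by rewrite normr0 mulr_ge0.
  have pos : 0 < `|P y - P z| by rewrite normr_gt0.
  rewrite -(ler_pM2r pos) -expr2 (le_trans (sqr_norm_le_dotcV _)) //.
  rewrite -mulrA (le_trans _ (dotcV_le _ _)) //.
  have := Pvar y _ (PK z); have := Pvar z _ (PK y).
  set v := P y - P z; have -> : P z - P y = -1 *: v by rewrite scaleN1r opprB.
  have -> : y - z = (y - P y) + (-1 *: (z - P z) + v).
    by rewrite scaleN1r opprB [_ + v]addrC !subrKA.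
  set a := y - P y; set b := z - P z.
  move: a b v => a b v.
  by rewrite 2!dotcVDl dotcVZl [dotcV a (_ *: _)]dotcVC dotcVZl [dotcV v a]dotcVC; lra.
apply/(@cvgrPdist_lt _ _ _ (nbhs y)) => e e0; near=> z.
(* Passing from [n%:R] to [n%:R + 1] allows the division when [n] is 0. *)
apply: le_lt_trans (lipP z) _; apply: (@le_lt_trans _ _ ((n%:R + 1) * `|y - z|)).
  by rewrite ler_wpM2r // lerDl.
rewrite mulrC -ltr_pdivlMr ?ltr_pwDr //; near: z.
have d0 : 0 < e / (n%:R + 1) by rewrite divr_gt0 // ltr_pwDr.
by have := nbhsx_ballx y _ d0; rewrite -ball_normE.
Unshelve. all: by end_near. Qed.

(** Composing [g] with the retraction gives a bounded continuous map of the whole space whose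
    values, hence fixed points, lie in [K]. *)
Lemma brouwer_cV (K : set 'cV[R]_n) (g : 'cV[R]_n -> 'cV[R]_n) :
  compact K -> convex_cV K -> K !=set0 ->
  {within K, continuous g} -> (forall x, K x -> K (g x)) ->
  exists2 x, K x & g x = x.
Proof.
move=> cK convK K0 /subspace_continuousP cg gK.
have [P [cP PK Pid]] := exists_retraction cK convK K0.
have [M _ KM] := ex_strict_bound_gt0 (compact_bounded cK).
have [|x|x gx] := @bounded_continuous_fixpoint R n M (g \o P).
- move=> y; apply: (@cvg_comp _ _ _ P g _ (within K (nbhs (P y)))); last exact: cg.
  move=> U KU; have : nbhs y (P @^-1` [set z | K z -> U z]) := cP y _ KU.
  by apply: filterS => z; apply.
- exact/ltW/KM/gK/PK.
- by exists x; [rewrite -gx; exact/gK/PK|rewrite -[RHS]gx /= Pid // -gx; exact/gK/PK].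
Qed.
End ConvexProjection.

(** * Polyhedra and interval enclosures *)

Section Polyhedron.
Variables (R : realType) (p n : nat) (A : 'M[R]_(p, n)) (b : 'cV[R]_p).

Lemma closed_Pset : closed (Pset A b).
Proof.
have -> : Pset A b =
    \bigcap_(i in [set: 'I_p]) (fun x => (A *m x) i 0) @^-1` [set y | y <= b i 0].
  by apply/seteqP; split=> [x Px i _|x Px i]; exact: Px.
apply: closed_bigI => i _; apply: preimage_closed (@closed_le _ _) => x _.
apply: (@continuous_comp _ _ _ (mulmx A) (fun y : 'cV_p => y i 0)).
  exact: continuous_mulmx.
exact: coord_continuous.
Qed.

Lemma convex_Pset : convex_cV (Pset A b).
Proof.
move=> x y t Px Py /andP[t0 t1] i.
rewrite mulmxDr -scalemxAr mulmxBr !mxE.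
have := Px i; have := Py i; rewrite !mxE.
move: (\sum_j _) (\sum_j _) (b i 0) => ax ay bi le_y le_x.
have := ler_wpM2l t0 le_y; have : (1 - t) * ax <= (1 - t) * bi.
  by rewrite ler_wpM2l // subr_ge0.
by lra.
Qed.
End Polyhedron.

(** This is the chain rule with a linear outer map, its own differential; basis vectors then
    identify the matrices. *)
Lemma partial_jac_x_mulmx (R : realType) (n m k l : nat) (M : 'M[R]_(k, l))
    (F : 'cV[R]_n * 'cV[R]_m -> 'cV[R]_l) x0 u0 J JM :
  partial_jac_x F x0 u0 J ->
  partial_jac_x (fun z => M *m F z) x0 u0 JM -> JM = M *m J.
Proof.
move=> [dF jacF] [_ jacMF]; have e (h : 'cV[R]_n) : JM *m h = M *m J *m h.
  rewrite -jacMF -mulmxA -jacF.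
  have cM := @continuous_mulmx R k l 1 M.
  have -> : (fun x => M *m F (x, u0)) = mulmx M \o (fun x => F (x, u0)) by [].
  rewrite diff_comp //; last exact: linear_differentiable.
  by rewrite /= diff_lin.
apply/matrixP => i j; have := congr1 (fun v : 'cV_k => v i 0) (e (delta_mx j 0)).
by rewrite -!colE !mxE.
Qed.

Section EnclosedProduct.
Variables (R : realType) (p q : nat) (K : 'M[R]_(p, q)).

(** Each term is bounded separately: the sign of [K i k] decides whether [hi] or [lo] gives the
    upper bound. *)
Lemma mulmx_le_posPart_negPart (lo v hi : 'cV[R]_q) i :
  (forall k, lo k 0 <= v k 0 <= hi k 0) ->
  (K *m v) i 0 <= (posPart K *m hi + negPart K *m lo) i 0.
Proof.
move=> H; rewrite !mxE -big_split /=; apply: ler_sum => k _; rewrite !mxE.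
have /andP[lo_v v_hi] := H k.
case: (ltrgtP (K i k) 0) => [K0|K0|->]; last by rewrite !mul0r addr0.
  by rewrite mul0r add0r ler_wnM2l // ltW.
by rewrite mul0r addr0 ler_wpM2l // ltW.
Qed.
End EnclosedProduct.

Theorem theorem2 (R : realType) (n m q p : nat)
  (f : 'cV[R]_n * 'cV[R]_m -> 'cV[R]_n)
  (psi : 'cV[R]_n * 'cV[R]_m -> 'cV[R]_q) (M : 'M[R]_(n, q))
  (x0 : 'cV[R]_n) (u0 : 'cV[R]_m) (Jf0 : 'M[R]_n) (Jpsi0 : 'M[R]_(q, n))
  (glo ghi : 'cV[R]_n -> 'cV[R]_m -> 'cV[R]_q) (A : 'M[R]_(p, n))
  (u : 'cV[R]_m) (b : 'cV[R]_p) :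
  continuous f ->
  (forall z, differentiable f z) ->
  cont_diff psi ->
  (forall z, f z = M *m psi z) ->
  f (x0, u0) = 0 ->
  partial_jac_x f x0 u0 Jf0 ->
  Jf0 \in unitmx ->
  partial_jac_x psi x0 u0 Jpsi0 ->
  (forall x u' k, glo x u' k 0 <= (psi (x, u') - Jpsi0 *m x) k 0
                  <= ghi x u' k 0) ->
  (forall b' : 'cV[R]_p, bounded_set (Pset A b')) ->
  (* the max / min defining gP_hi, gP_lo are attained at (u, b) *)
  (forall k, exists2 x, Pset A b x &
     forall y, Pset A b y -> ghi y u k 0 <= ghi x u k 0) ->
  (forall k, exists2 x, Pset A b x &
     forall y, Pset A b y -> glo x u k 0 <= glo y u k 0) ->
  Pset A b !=set0 ->
  (let K := - (A *m invmx Jf0 *m M) in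
   forall i, (posPart K *m gP_hi A ghi u b + negPart K *m gP_lo A glo u b) i 0
             <= b i 0) ->
  exists2 x, Pset A b x & f (x, u) = 0.
Proof.
move=> cf _ _ fE _ jf Junit jpsi gbnd Pbnd hi_att lo_att P0 Kle.
have JE : Jf0 = M *m Jpsi0.
  apply: (partial_jac_x_mulmx jpsi).
  by have -> : (fun z => M *m psi z) = f by apply/funext => z; rewrite fE.
pose T x := x - invmx Jf0 *m f (x, u).
have AT x : A *m T x = - (A *m invmx Jf0 *m M) *m (psi (x, u) - Jpsi0 *m x).
  rewrite /T fE mulNmx -!mulmxA (mulmxBr M) (mulmxA M Jpsi0 x) -JE.
  by rewrite (mulmxBr (invmx Jf0)) mulKmx // -mulmxN opprB.
have cT : continuous T.
  have cfu : continuous (fun x => f (x, u)).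
    move=> x; apply: (@continuous_comp _ _ _ (fun x => (x, u)) f); last exact: cf.
    by apply: (cvg_pair (F := nbhs x) (G := nbhs x) (H := nbhs u)) => //; exact: cvg_cst.
  have cJ : continuous (fun x => invmx Jf0 *m f (x, u)).
    move=> x; apply: (@continuous_comp _ _ _ (fun x => f (x, u)) (mulmx _)).
      exact: cfu.
    exact: continuous_mulmx.
  by move=> x; exact: (cvgB (@cvg_id _ (nbhs x)) (cJ x)).
have TP x : Pset A b x -> Pset A b (T x).
  move=> Px i; rewrite AT; apply: le_trans (Kle i).
  apply: mulmx_le_posPart_negPart => k.
  have /andP[lo_g g_hi] := gbnd x u k; rewrite !mxE in lo_g g_hi *.
  apply/andP; split.
    apply: le_trans lo_g; apply: ge_inf; last by exists x.
    (* Attainment shows that the set of values is bounded below, which makes [inf] a genuine lower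
       bound; [sup] is treated alike. *)
    have [y _ ymin] := lo_att k; exists (glo y u k 0) => _ [z Pz <-].
    exact: ymin.
  apply: (le_trans g_hi); apply: ub_le_sup; last by exists x.
  have [y _ ymax] := hi_att k; exists (ghi y u k 0) => _ [z Pz <-].
  exact: ymax.
have cptP : compact (Pset A b).
  by apply: bounded_closed_compact_cV; [exact: Pbnd|exact: closed_Pset].
have [x Px Tx] := brouwer_cV cptP (convex_Pset (b := b)) P0 (continuous_subspaceT cT) TP.
exists x => //; move: Tx => /eqP.
rewrite /T subr_eq addrC -subr_eq subrr eq_sym => /eqP Jf.
by rewrite -[f _](mulKVmx Junit) Jf mulmx0.
Qed.
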